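(* The Baxter monoid satisfies the identity $xyxyxy = xyyxxy$; that is, for all $x,y \in \mathcal{A}^*$, $xyxyxy \equiv_{\mathrm{baxt}} xyyxxy$.
   Context: $\mathcal{A} = \{1,2,3,\ldots\}$ with the usual order; $\mathcal{A}^*$ the free monoid over $\mathcal{A}$. $\mathrm{rtree}(a_1\cdots a_k)$ is the right strict binary search tree obtained from the empty tree by inserting $a_k,\ldots,a_1$ in turn, where inserting $a$ creates a node at an empty position and otherwise recurses into the left subtree if $a \le$ root label, into the right subtree otherwise. $\mathrm{ltree}(a_1\cdots a_k)$ is the left strict binary search tree obtained from the empty tree by inserting $a_1,\ldots,a_k$ in turn, where inserting $a$ recurses into the right subtree if $a \ge$ root label and into the left subtree otherwise. The Baxter congruence: $u \equiv_{\mathrm{baxt}} v$ iff $\mathrm{ltree}(u)=\mathrm{ltree}(v)$ and $\mathrm{rtree}(u)=\mathrm{rtree}(v)$; the Baxter monoid is $\mathcal{A}^*/{\equiv_{\mathrm{baxt}}}$. *)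

(* Defs.v *)
From mathcomp Require Import all_boot.

Set Implicit Arguments.
Unset Strict Implicit.
Unset Printing Implicit Defensive.

Definition letter := {n : nat | 0 < n}.

Definition word := seq letter.

Inductive btree : Type :=
| Empty
| Node (l : btree) (a : letter) (r : btree).

Fixpoint rinsert (a : letter) (t : btree) : btree :=
  match t with
  | Empty => Node Empty a Empty
  | Node l b r =>
      if val a <= val b then Node (rinsert a l) b r else Node l b (rinsert a r)
  end.

Fixpoint linsert (a : letter) (t : btree) : btree :=
  match t with
  | Empty => Node Empty a Empty
  | Node l b r =>
      if val b <= val a then Node l b (linsert a r) else Node (linsert a l) b r
  end.

(* [foldr] inserts the letters of [w] from last to first. *)
Definition rtree (w : word) : btree := foldr rinsert Empty w.

(* [foldl] inserts the letters of [w] from first to last. *)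
Definition ltree (w : word) : btree := foldl (fun t a => linsert a t) Empty w.

Definition baxt_equiv (u v : word) : Prop :=
  ltree u = ltree v /\ rtree u = rtree v.

(* Main.v *)
Require Import Defs.
From mathcomp Require Import all_boot.

(** Both sides of the identity are of the form [xy m xy], with middle factors
    that are permutations of each other. Once a binary search tree contains the
    letters [a] and [b], insertions of [a] and [b] commute: if [a < b], the
    searches part at a node labelled [a] (for [rtree]) or [b] (for [ltree]), at
    the latest. Hence, above a factor [xy] inserted first, only the multiset of
    the letters of the middle factor matters. *)

Set Implicit Arguments.
Unset Strict Implicit.
Unset Printing Implicit Defensive.

Section FoldrPerm.

Variables (T : eqType) (R : Type) (f : T -> R -> R) (ready : T -> pred R).
Hypothesis ready_stable : forall a b z, ready a z -> ready a (f b z).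
Hypothesis f_comm :
  forall a b z, ready a z -> ready b z -> f a (f b z) = f b (f a z).

Lemma foldr_stable a z s : ready a z -> ready a (foldr f z s).
Proof. by move=> ready_a; elim: s => //= b s; apply: ready_stable. Qed.

Lemma all_foldr_stable z s t :
  all (ready^~ z) t -> all (ready^~ (foldr f z s)) t.
Proof. by apply: sub_all => a; apply: foldr_stable. Qed.

Lemma foldr_comm a z s :
  ready a z -> all (ready^~ z) s -> f a (foldr f z s) = foldr f (f a z) s.
Proof.
move=> ready_a; elim: s => //= b s IHs /andP[ready_b ready_s].
by rewrite f_comm ?foldr_stable // IHs.
Qed.

Lemma foldr_catC z s t :
  all (ready^~ z) (s ++ t) -> foldr f z (s ++ t) = foldr f z (t ++ s).
Proof.
elim: s => [|a s IHs] /=; first by rewrite cats0.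
case/andP=> ready_a ready_st; rewrite IHs // !foldr_cat.
move: ready_st; rewrite all_cat => /andP[_ ready_t].
by rewrite foldr_comm ?foldr_stable ?all_foldr_stable.
Qed.

Lemma perm_foldr z u v :
  perm_eq u v -> all (ready^~ z) u -> foldr f z u = foldr f z v.
Proof.
move=> perm_uv ready_u.
pose same_fold s := all (ready^~ z) s /\ foldr f z u = foldr f z s.
suff: same_fold v by case.
apply: (catCA_perm_ind _ perm_uv) => // s1 s2 s3 [ready_s fold_u].
split; first by rewrite (perm_all _ (permEl (perm_catCA s2 s1 s3))).
rewrite fold_u !catA !(foldr_cat _ _ _ s3) foldr_catC // all_foldr_stable //.
by move: ready_s; rewrite catA all_cat => /andP[].
Qed.

End FoldrPerm.

Section Insertion.

Variable goleft : rel letter.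

Fixpoint insert (a : letter) (t : btree) : btree :=
  match t with
  | Empty => Node Empty a Empty
  | Node l b r =>
      if goleft a b then Node (insert a l) b r else Node l b (insert a r)
  end.

(* Following only the insertion path of [a] spares a search tree invariant. *)
Fixpoint lookup (a : letter) (t : btree) : bool :=
  match t with
  | Empty => false
  | Node l b r => (a == b) || lookup a (if goleft a b then l else r)
  end.

Definition bst (w : word) : btree := foldr insert Empty w.

Definition separating : Prop :=
  forall a b, a != b ->
    (goleft a a != goleft b a) || (goleft a b != goleft b b).

Lemma lookup_insert_same a t : lookup a (insert a t).
Proof.
elim: t => [|l IHl b r IHr] /=; first by rewrite eqxx.
by case: ifP => /= ->; rewrite ?IHl ?IHr orbT.
Qed.

Lemma lookup_insert a b t : lookup a t -> lookup a (insert b t).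
Proof.
elim: t => [//|l IHl c r IHr] /= /predU1P[->|found].
  by case: ifP; rewrite /= eqxx.
by case: (goleft b c); move: found => /=; case: ifP => _ found;
  rewrite ?IHl ?IHr ?found ?orbT.
Qed.

Lemma lookup_bst a w : a \in w -> lookup a (bst w).
Proof.
elim: w => //= b w IHw /predU1P[->|/IHw]; first exact: lookup_insert_same.
exact: lookup_insert.
Qed.

Lemma insert_comm_separated a b t :
  goleft a a != goleft b a -> lookup a t ->
  insert a (insert b t) = insert b (insert a t).
Proof.
move=> sep_a; elim: t => [//|l IHl c r IHr] /= /predU1P[<-|].
  by move: sep_a; case ga: (goleft a a); case gb: (goleft b a) => //= _;
    rewrite ga gb.
by case ga: (goleft a c); case gb: (goleft b c) => //= found;
  rewrite ga gb // ?IHl ?IHr.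
Qed.

Hypothesis goleft_sep : separating.

Lemma insert_comm a b t :
  lookup a t -> lookup b t -> insert a (insert b t) = insert b (insert a t).
Proof.
have [-> //|/goleft_sep/orP[sep_a|sep_b] found_a found_b] := eqVneq a b.
  exact: insert_comm_separated.
by apply/esym/insert_comm_separated; rewrite // eq_sym.
Qed.

Lemma bst_perm_middle s u v w :
  perm_eq u v -> {subset u <= w} -> bst (s ++ u ++ w) = bst (s ++ v ++ w).
Proof.
move=> perm_uv sub_uw; rewrite /bst !foldr_cat; congr foldr.
apply: (perm_foldr lookup_insert insert_comm perm_uv).
by apply/allP => a /sub_uw; apply: lookup_bst.
Qed.

End Insertion.

Lemma separating_leq : separating (relpre val leq).
Proof. by move=> a b; rewrite -val_eqE /= !leqnn; case: ltngtP. Qed.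

Lemma separating_ltn : separating (relpre val ltn).
Proof. by move=> a b; rewrite -val_eqE /= !ltnn; case: ltngtP. Qed.

Lemma rinsertE : rinsert =2 insert (relpre val leq).
Proof. by move=> a; elim=> //= l -> b r ->. Qed.

Lemma linsertE : linsert =2 insert (relpre val ltn).
Proof. by move=> a; elim=> //= l -> b r ->; rewrite leqNgt if_neg. Qed.

Lemma rtreeE w : rtree w = bst (relpre val leq) w.
Proof. by elim: w => //= a w ->; rewrite rinsertE. Qed.

Lemma ltreeE w : ltree w = bst (relpre val ltn) (rev w).
Proof.
rewrite /ltree -{1}[w]revK foldl_rev.
by elim: (rev w) => //= a s ->; rewrite linsertE.
Qed.

Lemma baxt_equiv_perm_middle s u v w :
  perm_eq u v -> {subset u <= s} -> {subset u <= w} ->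
  baxt_equiv (s ++ u ++ w) (s ++ v ++ w).
Proof.
move=> perm_uv sub_us sub_uw; split; last first.
  by rewrite !rtreeE; apply: (bst_perm_middle separating_leq).
rewrite !ltreeE !rev_cat -!catA.
apply: (bst_perm_middle separating_ltn).
  by rewrite perm_rev perm_sym perm_rev perm_sym.
by move=> a; rewrite !mem_rev => /sub_us.
Qed.

Theorem theorem6 (x y : word) :
  baxt_equiv (x ++ y ++ x ++ y ++ x ++ y) (x ++ y ++ y ++ x ++ x ++ y).
Proof.
have perm_xy : perm_eq (x ++ y) (y ++ x) by rewrite perm_catC.
have := @baxt_equiv_perm_middle (x ++ y) _ _ (x ++ y) perm_xy.
by rewrite -!catA; apply.
Qed.
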